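(* Let $(v^h,q^h)$, $v^h:(0,T]\to X^h$, $q^h:(0,T]\to Q^h$, be a solution of the semi-discrete nudged problem: for all $w^h\in X^h$ and $\lambda^h\in Q^h$, $$\Big(\frac{\partial v^h}{\partial t},w^h\Big)+b^*(v^h,v^h,w^h)+\nu(\nabla v^h,\nabla w^h)-(q^h,\nabla\cdot w^h)-\chi(I_H(u-v^h),w^h)=(f,w^h),$$ $$(\nabla\cdot v^h,\lambda^h)-\mu_1(I_H(p-q^h),\lambda^h)-\mu_2(I_Hq^h-q^h,\lambda^h)=0.$$ Assume $I_H$ is an $L^2$-projection. Then $$\frac{d\|v^h\|^2}{dt}+\nu\|\nabla v^h\|^2+\chi\|I_H(v^h)\|^2+\alpha_1\|q^h\|^2\le \chi\|I_H(u)\|^2+\mu_1\|I_H(p)\|^2+\frac1\nu\|f\|_{-1}^2,$$ where $\alpha_1=\min\{\mu_1,2\mu_2\}$.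
   Context: $\Omega\subset\mathbb{R}^d$, $d=2$ or $3$, is a domain; $\|\cdot\|$ and $(\cdot,\cdot)$ are the $L^2(\Omega)$ norm and inner product. $X=(H_0^1(\Omega))^d$, $Q=L_0^2(\Omega)$ (mean-zero $L^2$ functions), and $X^h\subset X$, $Q^h\subset Q$ are conforming finite element spaces. The dual norm is $\|f\|_{-1}=\sup_{0\ne v\in X}\langle f,v\rangle/\|\nabla v\|$. The skew-symmetrized trilinear form is $b^*(u,v,w)=\frac12(u\cdot\nabla v,w)-\frac12(u\cdot\nabla w,v)$. $\nu>0$ is the viscosity, $\chi>0$ the velocity nudging parameter, $\mu_1,\mu_2>0$ the pressure nudging parameters, $f$ the body force. $I_H$ is the observation operator of spatial resolution $H$, applied to both velocities (vector functions) and pressures (scalar functions); that it is an $L^2$-projection means it is the orthogonal projection in $L^2$ onto its range. $(u,p)$ is the reference velocity and pressure (a solution of the slightly compressible Navier--Stokes equations) whose observations $I_H(u)$, $I_H(p)$ are the given data. *)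

(* Defs.v *)
From HB Require Import structures.
From mathcomp Require Import all_boot all_order all_algebra.
From mathcomp Require Import all_classical all_reals all_analysis.
From mathcomp Require Import measurable_realfun.

Set Implicit Arguments.
Unset Strict Implicit.
Unset Printing Implicit Defensive.

Import Order.TTheory GRing.Theory Num.Theory.
Import numFieldNormedType.Exports.

Local Open Scope classical_set_scope.
Local Open Scope ring_scope.

Definition rV_display : measure_display.
Proof. exact. Qed.

Section rV_measurable.
Variables (R : realType) (n : nat).

Definition rV_coord (i : 'I_n) (x : 'rV[R]_n) : measurableTypeR R := x ord0 i.

Let rV_set0 : g_sigma_preimage rV_coord set0.
Proof. exact: sigma_algebra0. Qed.

Let rV_setC A : g_sigma_preimage rV_coord A -> g_sigma_preimage rV_coord (~` A).
Proof. exact: sigma_algebraC. Qed.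

Let rV_bigcup (F : _^nat) : (forall i, g_sigma_preimage rV_coord (F i)) ->
  g_sigma_preimage rV_coord (\bigcup_i (F i)).
Proof. exact: sigma_algebra_bigcup. Qed.

(* The product sigma-algebra of n copies of the Borel sets of R, that is, the
   Borel sigma-algebra of R^n (see open_measurable_rV). *)
HB.instance Definition _ := @isMeasurable.Build rV_display
  'rV[R]_n (g_sigma_preimage rV_coord) rV_set0 rV_setC rV_bigcup.


Lemma measurable_rV_coord (i : 'I_n) : measurable_fun setT (rV_coord i).
Proof.
move=> _ A mA; rewrite setTI; apply: sub_sigma_algebra.
by rewrite (bigD1 i)//=; left; exists A => //; rewrite setTI.
Qed.

Lemma measurable_fun_rV d (T : measurableType d) (f : T -> 'rV[R]_n) :
  (forall i, measurable_fun setT (rV_coord i \o f)) -> measurable_fun setT f.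
Proof.
move=> mf _ A; rewrite setTI.
suff : g_sigma_preimage rV_coord `<=` [set B | measurable (f @^-1` B)].
  by move=> + mA; exact.
apply: smallest_sub.
  split=> /=.
  - by rewrite preimage_set0.
  - by move=> B mB; rewrite setTD preimage_setC; exact: measurableC.
  - by move=> F mF; rewrite preimage_bigcup; exact: bigcupT_measurable.
apply: (big_ind (fun S => S `<=` _)) => //=.
- by move=> B C mB mC; rewrite subUset.
- by move=> i _ _ [B mB <-]/=; rewrite setTI -[X in measurable X]setTI; exact: mf.
Qed.

Let box (c : {ffun 'I_n -> rat} * nat) : set 'rV[R]_n :=
  \bigcap_(i in [set: 'I_n])
    (rV_coord i @^-1` ball (ratr (c.1 i) : R) c.2.+1%:R^-1).

Let measurable_box c : measurable (box c).
Proof.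
apply: fin_bigcap_measurable => // i _; rewrite -[X in measurable X]setTI.
by apply: measurable_rV_coord => //; exact: measurable_ball.
Qed.

Lemma open_measurable_rV (U : set 'rV[R]_n) : open U -> measurable U.
Proof.
move=> oU.
rewrite (_ : U = \bigcup_c (if `[< box c `<=` U >] then box c else set0)).
  by apply: countable_bigcupT_measurable => // c; case: ifPn.
apply/seteqP; split => [x Ux|x [c _]]; last first.
  by case: ifPn => // /asboolP; exact.
have /nbhs_ballP[e /= e0 xeU] : nbhs x U by exact: open_nbhs_nbhs.
have [k ke] : exists k, k.+1%:R^-1 < e / 2.
  have e20 : 0 < e / 2 by rewrite divr_gt0.
  have [N _ /(_ N (leqnn N)) Ne] := near_infty_natSinv_lt (PosNum e20).
  by exists N.
have k0 : 0 < k.+1%:R^-1 :> R by rewrite invr_gt0.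
have /boolp.choice[c cx] i :
    exists q : rat, `|x ord0 i - ratr q| < k.+1%:R^-1.
  have [q] : exists q : rat, ratr q \in `]x ord0 i, x ord0 i + k.+1%:R^-1[.
    by apply: rat_in_itvoo; rewrite ltrDl.
  rewrite in_itv/= => /andP[xq qx]; exists q.
  by rewrite distrC ger0_norm ?subr_ge0 ?ltW// ltrBlDl.
exists ([ffun i => c i], k) => //; case: ifPn => [_ i _ /=|/asboolP[y cy]].
  by rewrite /ball/= ffunE distrC; exact: cx.
apply: xeU; rewrite /ball/=; split => // i j; rewrite !ord1.
have := cy j Logic.I; rewrite /= /ball/= ffunE => {}cy.
rewrite -(subrKA (ratr (c j))) (le_lt_trans (ler_normD _ _))// [e]splitr.
by rewrite ltrD// (lt_trans _ ke)//; exact: cx.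
Qed.

End rV_measurable.

Section lebesgue_rV.
Variable R : realType.

Definition rV_cons n (p : measurableTypeR R * 'rV[R]_n) : 'rV[R]_n.+1 :=
  row_mx (p.1%:M : 'rV[R]_1) p.2.

Lemma measurable_rV_cons n : measurable_fun setT (@rV_cons n).
Proof.
apply: measurable_fun_rV => i; have [j ->|j ->] := @split_ordP 1 n i.
- rewrite (_ : _ \o _ = fst); first exact: measurable_fst.
  apply/funext => p; apply: etrans (row_mxEl _ _ _ _) _.
  by rewrite !ord1 mxE.
- rewrite (_ : _ \o _ = rV_coord j \o snd).
    exact: measurableT_comp (measurable_rV_coord j) measurable_snd.
  by apply/funext => p; exact: row_mxEr.
Qed.

Section lebesgue_cons.
Variables (n : nat) (m : {measure set 'rV[R]_n -> \bar R}).

Definition lebesgue_cons : set 'rV[R]_n.+1 -> \bar R :=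
  pushforward (@lebesgue_measure R \x^ m)%E (@rV_cons n).

Let mc := @measurable_rV_cons n.

Let lebesgue_cons0 : lebesgue_cons set0 = 0%E.
Proof. exact: measure0. Qed.

Let lebesgue_cons_ge0 A : (0 <= lebesgue_cons A)%E.
Proof. exact: measure_ge0. Qed.

Let lebesgue_cons_sigma_additive : semi_sigma_additive lebesgue_cons.
Proof. exact: measure_semi_sigma_additive. Qed.

HB.instance Definition _ := isMeasure.Build _ _ _ lebesgue_cons
  lebesgue_cons0 lebesgue_cons_ge0 lebesgue_cons_sigma_additive.

End lebesgue_cons.

(* Lebesgue measure on the Borel sets of R^n, as the n-fold iterated product of
   the one on R; R^0 is a point of measure 1. *)
Fixpoint lebesgue_rV n : {measure set 'rV[R]_n -> \bar R} :=
  match n with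
  | 0 => dirac (0 : 'rV[R]_0)
  | n'.+1 => lebesgue_cons (lebesgue_rV n')
  end.

Lemma lebesgue_rV_box n (A : 'I_n -> set (measurableTypeR R)) :
  (forall i, measurable (A i)) ->
  lebesgue_rV n [set x | forall i, A i (x ord0 i)] =
  (\prod_(i < n) lebesgue_measure (A i))%E.
Proof.
elim: n A => [|n IH] A mA.
  by rewrite big_ord0 /= diracE mem_set// => -[].
have mB : measurable [set x : 'rV[R]_n | forall i, A (lift ord0 i) (x ord0 i)].
  rewrite (_ : mkset _ =
      \bigcap_(i in [set: 'I_n]) (rV_coord i @^-1` A (lift ord0 i))).
    apply: fin_bigcap_measurable => // i _; rewrite -[X in measurable X]setTI.
    by apply: measurable_rV_coord.
  by apply/seteqP; split => x /= Ax i; [move=> _|]; exact: (Ax i).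
rewrite big_ord_recl -IH// -product_measure2E//=.
rewrite /lebesgue_cons /pushforward; congr (_ _).
have c0 x (y : 'rV[R]_n) : rV_cons (x, y) ord0 ord0 = x.
  transitivity (rV_cons (x, y) ord0 (lshift n (ord0 : 'I_1))).
    by congr (_ _ _); exact/val_inj.
  by apply: etrans (row_mxEl _ _ _ _) _; rewrite mxE.
have cS x (y : 'rV[R]_n) i : rV_cons (x, y) ord0 (lift ord0 i) = y ord0 i.
  transitivity (rV_cons (x, y) ord0 (rshift 1 i)).
    by congr (_ _ _); exact/val_inj.
  exact: row_mxEr.
apply/seteqP; split => -[x y] /=.
  move=> Axy; split => [|i]; first by have := Axy ord0; rewrite c0.
  by have := Axy (lift ord0 i); rewrite cS.
move=> [Ax Ay] i; have [j ->|->] := unliftP ord0 i; first by rewrite cS.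
by rewrite c0.
Qed.

End lebesgue_rV.

Record domain (R : realType) (d : nat) := Domain {
  domain_set :> set 'rV[R]_d;
  domain_open : open domain_set;
  domain_connected : connected domain_set;
  domain_neq0 : domain_set !=set0
}.
Arguments domain_open {R d} _.

Section function_spaces.
Context {R : realType} {d : nat} (Omega : domain R d).

Implicit Types (f g phi : 'rV[R]_d -> R) (u v w : 'rV[R]_d -> 'rV[R]_d).

(* Lebesgue measure restricted to Omega: functions "on Omega" are represented
   by functions on R^d whose values outside Omega are irrelevant. *)
Definition dx : {measure set 'rV[R]_d -> \bar R} :=
  mrestr (lebesgue_rV R d) (open_measurable_rV (domain_open Omega)).

Definition L2 f : Prop := f \in Lfun dx 2%:E.

Definition inner f g : R := (\int[dx]_x (f x * g x))%R.

Definition norm2 f : R := Num.sqrt (inner f f).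

Definition L2M m n (A : 'rV[R]_d -> 'M[R]_(m, n)) : Prop :=
  forall i j, L2 (fun x => A x i j).

Definition innerM m n (A B : 'rV[R]_d -> 'M[R]_(m, n)) : R :=
  \sum_(i < m) \sum_(j < n) inner (fun x => A x i j) (fun x => B x i j).

Definition norm2M m n (A : 'rV[R]_d -> 'M[R]_(m, n)) : R :=
  Num.sqrt (innerM A A).

Definition partial (i : 'I_d) f : 'rV[R]_d -> R := 'D_(delta_mx ord0 i) f.

Fixpoint Ck (k : nat) f : Prop :=
  continuous f /\
  if k is k'.+1 then
    forall i, (forall x, derivable f x (delta_mx ord0 i)) /\ Ck k' (partial i f)
  else True.

Definition test_function phi : Prop :=
  let supp := closure [set x | phi x != 0] in
  [/\ forall k, Ck k phi, compact supp & supp `<=` Omega].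

Definition weak_partial_of (i : 'I_d) f g : Prop :=
  L2 g /\ forall phi, test_function phi ->
    inner f (partial i phi) = - inner g phi.

Definition H1 f : Prop := L2 f /\ forall i, exists g, weak_partial_of i f g.

(* A representative of the weak derivative, which is unique almost everywhere;
   only meaningful on H1. *)
Definition weak_partial (i : 'I_d) f : 'rV[R]_d -> R :=
  xget (cst 0) [set g | weak_partial_of i f g].

Definition normH1 f : R :=
  Num.sqrt (norm2 f ^+ 2 + \sum_(i < d) norm2 (weak_partial i f) ^+ 2).

Definition H10 f : Prop :=
  H1 f /\ forall e : R, 0 < e ->
    exists2 phi, test_function phi & normH1 (f \- phi) < e.

Definition velocity_space : set ('rV[R]_d -> 'rV[R]_d) :=
  [set v | forall i, H10 (fun x => v x ord0 i)].

(* On a domain of finite measure the integrability condition is redundant. *)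
Definition pressure_space : set ('rV[R]_d -> R) :=
  [set q | [/\ L2 q, dx.-integrable setT (EFin \o q) &
               (\int[dx]_x q x)%R = 0]].

Definition grad v : 'rV[R]_d -> 'M[R]_d := fun x =>
  \matrix_(i, j) weak_partial j (fun y => v y ord0 i) x.

Definition divergence v : 'rV[R]_d -> R := fun x =>
  \sum_(i < d) weak_partial i (fun y => v y ord0 i) x.

Definition convection u v : 'rV[R]_d -> 'rV[R]_d := fun x =>
  \row_j \sum_(i < d) u x ord0 i * weak_partial i (fun y => v y ord0 j) x.

Definition bstar u v w : R :=
  2^-1 * innerM (convection u v) w - 2^-1 * innerM (convection u w) v.

(* F is a continuous linear functional on the velocity space normed by
   |grad v|; since elements of that space are represented by functions, F must
   not distinguish functions that agree almost everywhere. *)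
Definition velocity_dual (F : ('rV[R]_d -> 'rV[R]_d) -> R) : Prop :=
  [/\ forall v w, velocity_space v -> velocity_space w ->
        v = w %[ae dx] -> F v = F w,
      forall a v w, velocity_space v -> velocity_space w ->
        F (a *: v + w) = a * F v + F w &
      exists C : R, forall v, velocity_space v ->
        `|F v| <= C * norm2M (grad v)].

Definition dual_norm (F : ('rV[R]_d -> 'rV[R]_d) -> R) : R :=
  sup [set r | exists v, [/\ velocity_space v, ~ (v = cst 0 %[ae dx]) &
                             r = F v / norm2M (grad v)]].

End function_spaces.

Definition finite_dim_subspace (R : realType) (V : lmodType R) (S : set V) :=
  exists (n : nat) (e : 'I_n -> V),
    S = [set v | exists c : 'I_n -> R, v = \sum_(i < n) c i *: e i].

(* I is the orthogonal projection onto its range in the space L with inner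
   product ip, where elements of L are functions identified along sim; range is
   the set of all representatives of the classes of the images I g. *)
Definition orth_projection_onto_range (R : realType) (V : lmodType R)
    (L : set V) (ip : V -> V -> R) (sim : V -> V -> Prop) (I : V -> V) : Prop :=
  let range := [set w | L w /\ exists2 g, L g & sim w (I g)] in
  [/\ forall g, L g -> L (I g),
      forall a v w, range v -> range w -> range (a *: v + w) &
      forall g w, L g -> range w -> ip (g - I g) w = 0].

Definition L2_projection (R : realType) (d : nat) (Omega : domain R d)
    (I : ('rV[R]_d -> R) -> ('rV[R]_d -> R)) : Prop :=
  orth_projection_onto_range (@L2 R d Omega) (inner Omega)
    (fun f g => f = g %[ae dx Omega]) I.

Definition L2_projection_vector (R : realType) (d : nat) (Omega : domain R d)
    (I : ('rV[R]_d -> 'rV[R]_d) -> ('rV[R]_d -> 'rV[R]_d)) : Prop :=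
  orth_projection_onto_range (@L2M R d Omega 1 d) (@innerM R d Omega 1 d)
    (fun f g => f = g %[ae dx Omega]) I.

(* Derivatives along A: two-sided at interior points of A, one-sided at the
   right end point T of A = ]0, T]. *)
Definition derivative_in (R : realType) (A : set R) (g : R -> R) (t l : R) :=
  (fun s => (s - t)^-1 * (g s - g t)) @ within A t^' --> l.

Definition L2_derivative_in (R : realType) (d : nat) (Omega : domain R d)
    (A : set R) (v : R -> 'rV[R]_d -> 'rV[R]_d) (t : R)
    (v' : 'rV[R]_d -> 'rV[R]_d) :=
  (fun s => norm2M Omega ((s - t)^-1 *: (v s - v t) - v')) @ within A t^'
    --> (0 : R).

(* Main.v *)
(* Test the two equations with w = v^h and lambda = q^h and add them: the
   convective term vanishes by skew symmetry and the pressure-divergence terms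
   cancel.  Since I_H is self-adjoint and idempotent,
   (I_H(g - h), h) = (I_H g, I_H h) - |I_H h|^2, which yields
     D/2 + nu |grad v|^2 + chi |I_H v|^2 + mu1 |I_H q|^2
         + mu2 (|q|^2 - |I_H q|^2)
       = f(v) + chi (I_H u, I_H v) + mu1 (I_H p, I_H q).
   Young's inequality on each term of the right-hand side, followed by
   |I_H q| <= |q| and the definition of alpha1, gives the estimate. *)

Require Import Defs.
From HB Require Import structures.
From mathcomp Require Import all_boot all_order all_algebra.
From mathcomp Require Import all_classical all_reals all_analysis.
From mathcomp Require Import ring lra.

Set Implicit Arguments.
Unset Strict Implicit.
Unset Printing Implicit Defensive.

Import Order.TTheory GRing.Theory Num.Theory.
Import numFieldNormedType.Exports.

Local Open Scope classical_set_scope.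
Local Open Scope ring_scope.

(** * Semi-inner products on a set of vectors: Cauchy-Schwarz and differentiation of the square *)

Section semi_inner_product.
Variables (R : realType) (V : lmodType R).
Implicit Types (L : set V) (ip : V -> V -> R) (v w z : V).

(** Positivity comes without definiteness, since functions are not quotiented by almost everywhere
    equality. Linearity is confined to [L], where products are integrable. *)
Definition semi_inner_product L ip : Prop :=
  [/\ forall a v w, L v -> L w -> L (a *: v + w),
      forall v w, ip v w = ip w v,
      forall a v w z, L v -> L w -> L z ->
        ip (a *: v + w) z = a * ip v z + ip w z &
      forall v, 0 <= ip v v].

Variables (L : set V) (ip : V -> V -> R).
Hypothesis ipL : semi_inner_product L ip.

Lemma sip_closedZ a v w : L v -> L w -> L (a *: v + w).
Proof. by case: ipL => + _ _ _; exact. Qed.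

Lemma sip_closedB v w : L v -> L w -> L (v - w).
Proof. by move=> Lv Lw; rewrite addrC -scaleN1r; exact: sip_closedZ. Qed.

Lemma sip_sym v w : ip v w = ip w v.
Proof. by case: ipL. Qed.

Lemma sip_ge0 v : 0 <= ip v v.
Proof. by case: ipL. Qed.

Lemma sip_linearl a v w z : L v -> L w -> L z ->
  ip (a *: v + w) z = a * ip v z + ip w z.
Proof. by case: ipL => _ _ + _; exact. Qed.

Lemma sipBl v w z : L v -> L w -> L z -> ip (v - w) z = ip v z - ip w z.
Proof.
by move=> Lv Lw Lz; rewrite addrC -scaleN1r sip_linearl// mulN1r addrC.
Qed.

Lemma sip_quadratic a v w : L v -> L w ->
  ip (a *: v + w) (a *: v + w) = a ^+ 2 * ip v v + 2 * a * ip v w + ip w w.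
Proof.
move=> Lv Lw; have La := sip_closedZ a Lv Lw.
rewrite sip_linearl// (sip_sym v) (sip_sym w (_ + _)) !sip_linearl//.
by rewrite (sip_sym w v); ring.
Qed.

Lemma sip_young v w : L v -> L w -> 2 * ip v w <= ip v v + ip w w.
Proof.
move=> Lv Lw; have := sip_ge0 (-1 *: v + w); rewrite sip_quadratic//; lra.
Qed.

Lemma sip_cauchy_schwarz v w : L v -> L w -> ip v w ^+ 2 <= ip v v * ip w w.
Proof.
move=> Lv Lw.
have q a : 0 <= a ^+ 2 * ip v v + 2 * a * ip v w + ip w w.
  by rewrite -sip_quadratic ?sip_ge0.
have [vv0|vv0] := eqVneq (ip v v) 0.
  have [->|vw0] := eqVneq (ip v w) 0; first by rewrite vv0 expr0n mul0r.
  (* With [ip v v = 0] the quadratic is affine in [a]; this choice gives it the value -1, a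
     contradiction. *)
  have := q (- (ip w w + 1) / (2 * ip v w)); rewrite vv0 mulr0 add0r.
  have -> : 2 * (- (ip w w + 1) / (2 * ip v w)) * ip v w = - (ip w w + 1).
    by field.
  lra.
have vv_gt0 : 0 < ip v v by rewrite lt_neqAle eq_sym vv0 sip_ge0.
(* The minimiser of the quadratic; the factor [ip v v] clears the denominator. *)
have := mulr_ge0 (ltW vv_gt0) (q (- ip v w / ip v v)).
have -> : ip v v * ((- ip v w / ip v v) ^+ 2 * ip v v +
    2 * (- ip v w / ip v v) * ip v w + ip w w) =
  ip v v * ip w w - ip v w ^+ 2 by field.
by rewrite subr_ge0.
Qed.

(** Strong convergence implies weak convergence: Cauchy-Schwarz squeezes the pairing between 0 and
    |e| |z|. *)
Lemma sip_cvg0 (X : Type) (F : set_system X) {FF : Filter F} (e : X -> V) z :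
  (\forall x \near F, L (e x)) -> L z ->
  (fun x => Num.sqrt (ip (e x) (e x))) @ F --> (0 : R) ->
  (fun x => ip (e x) z) @ F --> (0 : R).
Proof.
move=> Le Lz e0; apply/norm_cvg0P.
apply: (@squeeze_cvgr _ _ _ _ (cst 0)
  (fun x => Num.sqrt (ip (e x) (e x)) * Num.sqrt (ip z z))).
- near=> x; rewrite normr_ge0/= -sqrtrM ?sip_ge0// -sqrtr_sqr ler_wsqrtr//.
  by apply: sip_cauchy_schwarz => //; near: x.
- exact: cvg_cst.
- by rewrite -[X in _ --> X](mul0r (Num.sqrt (ip z z))); exact: cvgMl.
Unshelve. all: by end_near. Qed.

(* With e the error of the difference quotient, v s = v t + (s - t) (e s + v'),
   so the quotient of |v|^2 is 2 (e s + v', v t) + (s - t) |e s + v'|^2. *)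
Lemma sip_derivative (A : set R) (v : R -> V) (t : R) (v' : V) :
  (forall s, A s -> L (v s)) -> A t -> L v' ->
  (fun s => let e := (s - t)^-1 *: (v s - v t) - v' in Num.sqrt (ip e e))
    @ within A t^' --> (0 : R) ->
  derivative_in A (fun s => ip (v s) (v s)) t (2 * ip v' (v t)).
Proof.
move=> Lv At Lv' /=; set e := fun s => (s - t)^-1 *: (v s - v t) - v'.
move=> e0.
have Le s : A s -> L (e s).
  (* Closure is stated for [a *: v + w] only, so a zero summand is supplied as [v' - v']. *)
  move=> As; rewrite /e -[_ *: _]addr0 -(subrr v').
  by apply: sip_closedB => //; apply: sip_closedZ; apply: sip_closedB; auto.
have nLe : \forall s \near within A t^', L (e s).
  by near=> s; apply: Le; near: s; exact: withinT.
have neqt : \forall s \near within A t^', s != t.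
  by apply: (@cvg_within _ t^'); exact: withinT.
have ez z : L z -> (fun s => ip (e s) z) @ within A t^' --> (0 : R).
  by move=> Lz; exact: sip_cvg0.
(* The limit is written with its vanishing terms, to match the expanded quotient factor by
   factor. *)
rewrite /derivative_in (_ : 2 * _ = 2 * ip v' (v t) + 2 * 0 +
  (t - t) * (ip v' v' + 2 * 0 + 0 ^+ 2)); last by rewrite subrr; ring.
apply: (@cvg_trans _ ((fun s => 2 * ip v' (v t) + 2 * ip (e s) (v t) +
  (s - t) * (ip v' v' + 2 * ip (e s) v' + Num.sqrt (ip (e s) (e s)) ^+ 2))
  @ within A t^')).
  apply: near_eq_cvg; near=> s.
  have As : A s by near: s; exact: near_withinT.
  have st : s - t != 0 by rewrite subr_eq0; near: s.
  have Les := Le _ As; have Lvt := Lv _ At.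
  have we : (s - t)^-1 *: (v s - v t) = 1 *: e s + v'.
    by rewrite scale1r subrK.
  have Lw : L (1 *: e s + v') by exact: sip_closedZ.
  have vs : v s = (s - t) *: (1 *: e s + v') + v t.
    by rewrite -we scalerA divff// scale1r subrK.
  rewrite [in RHS]vs (sip_quadratic (s - t) Lw Lvt).
  rewrite (sip_linearl 1 Les Lv' Lvt) (sip_quadratic 1 Les Lv').
  rewrite sqr_sqrtr ?sip_ge0//; by field.
have st0 : (fun s => s - t) @ within A t^' --> t - t.
  apply: cvgB; last exact: cvg_cst.
  by move=> P tP; apply: cvg_within; exact: cvg_within.
apply: cvgD.
  apply: cvgD; first exact: cvg_cst.
  by apply: cvgM; [exact: cvg_cst|apply: ez; exact: Lv].
apply: cvgM => //; apply: cvgD.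
  by apply: cvgD; [exact: cvg_cst|apply: cvgM; [exact: cvg_cst|exact: ez]].
by rewrite !expr2; apply: cvgM.
Unshelve. all: by end_near. Qed.

(** * Orthogonal projections *)

Variables (sim : V -> V -> Prop) (I : V -> V).
Hypothesis sim_refl : forall v, sim v v.
Hypothesis I_proj : orth_projection_onto_range L ip sim I.

Lemma orth_projection_closed g : L g -> L (I g).
Proof. by case: I_proj => + _ _; exact. Qed.

(** The residual [h - I h] is orthogonal to the range, and reflexivity of [sim] puts [I g] in it. *)
Lemma orth_projectionE g h : L g -> L h -> ip (I g) h = ip (I g) (I h).
Proof.
move=> Lg Lh; apply/eqP; rewrite -subr_eq0 !(sip_sym (I g)).
have LIg := orth_projection_closed Lg; have LIh := orth_projection_closed Lh.
rewrite -sipBl//; case: I_proj => _ _ -> //; split => //.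
by exists g.
Qed.

(** The difference is not split under [I]: self-adjointness first turns the left side into
    [ip (I h) (g - h)], where bilinearity of [ip] applies. *)
Lemma orth_projectionB g h : L g -> L h ->
  ip (I (g - h)) h = ip (I g) (I h) - ip (I h) (I h).
Proof.
move=> Lg Lh; have Lgh := sip_closedB Lg Lh.
have LIh := orth_projection_closed Lh.
rewrite (orth_projectionE Lgh Lh) (sip_sym (I _)) -(orth_projectionE Lh Lgh).
rewrite sip_sym sipBl// (sip_sym g) (sip_sym h).
by rewrite (orth_projectionE Lh Lg) (orth_projectionE Lh Lh) sip_sym.
Qed.

(** Young's inequality for [I h] and [h], whose pairing is itself [ip (I h) (I h)]. *)
Lemma orth_projection_le h : L h -> ip (I h) (I h) <= ip h h.
Proof.
move=> Lh; have LIh := orth_projection_closed Lh.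
have := sip_young LIh Lh; rewrite (orth_projectionE Lh Lh); lra.
Qed.

End semi_inner_product.

(** * The L2 inner products of scalar and matrix fields, and the dual norm *)

Section L2_inner.
Variables (R : realType) (d : nat) (Omega : domain R d).

Lemma L2_linear (a : R) (f g : 'rV[R]_d -> R) :
  L2 Omega f -> L2 Omega g -> L2 Omega (fun x => a * f x + g x).
Proof.
have p1 : (1 <= 2%:E :> \bar R)%E by rewrite lee_fin ler1n.
move=> Lf Lg; have [_ closed] := Lfun_submod_closed (dx Omega) p1.
exact: (closed a f g).
Qed.

Lemma L2_integrableM (f g : 'rV[R]_d -> R) : L2 Omega f -> L2 Omega g ->
  (dx Omega).-integrable setT (EFin \o (fun x => f x * g x)).
Proof. by move=> Lf Lg; exact/Lfun1_integrable/Lfun2_mul_Lfun1. Qed.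

Lemma inner_linearl (a : R) (f g h : 'rV[R]_d -> R) :
  L2 Omega f -> L2 Omega g -> L2 Omega h ->
  inner Omega (fun x => a * f x + g x) h =
  a * inner Omega f h + inner Omega g h.
Proof.
move=> Lf Lg Lh; rewrite /inner.
have fh := L2_integrableM Lf Lh; have gh := L2_integrableM Lg Lh.
rewrite -RintegralZl// -RintegralD//; last first.
  by apply: eq_integrable (integrableZl _ a fh).
by apply: eq_Rintegral => x _; rewrite mulrDl mulrA.
Qed.

Lemma inner_sym (f g : 'rV[R]_d -> R) : inner Omega f g = inner Omega g f.
Proof. by apply: eq_Rintegral => x _; rewrite mulrC. Qed.

Lemma inner_ge0 (f : 'rV[R]_d -> R) : 0 <= inner Omega f f.
Proof. by apply: Rintegral_ge0 => x _; rewrite -expr2 sqr_ge0. Qed.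

Lemma inner_sip : semi_inner_product (@L2 R d Omega) (inner Omega).
Proof.
split; [exact: L2_linear|exact: inner_sym|exact: inner_linearl|exact: inner_ge0].
Qed.

Lemma innerM_ge0 m n (A : 'rV[R]_d -> 'M[R]_(m, n)) : 0 <= innerM Omega A A.
Proof. by do 2!apply: sumr_ge0 => ? _; exact: inner_ge0. Qed.

Lemma innerM_sip m n :
  semi_inner_product (@L2M R d Omega m n) (@innerM R d Omega m n).
Proof.
split.
- move=> a A B LA LB i j.
  rewrite (_ : (fun x => _) = fun x => a * A x i j + B x i j).
    exact: L2_linear.
  by apply/funext => x; rewrite !mxE.
- by move=> A B; do 2!apply: eq_bigr => ? _; exact: inner_sym.
- move=> a A B C LA LB LC; rewrite /innerM mulr_sumr -big_split/=.
  apply: eq_bigr => i _; rewrite mulr_sumr -big_split/=.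
  apply: eq_bigr => j _; rewrite -inner_linearl//.
  by congr inner; apply/funext => x; rewrite !mxE.
- exact: innerM_ge0.
Qed.

Lemma norm2_sqr (f : 'rV[R]_d -> R) : norm2 Omega f ^+ 2 = inner Omega f f.
Proof. by rewrite sqr_sqrtr ?inner_ge0. Qed.

Lemma norm2M_sqr m n (A : 'rV[R]_d -> 'M[R]_(m, n)) :
  norm2M Omega A ^+ 2 = innerM Omega A A.
Proof. by rewrite sqr_sqrtr ?innerM_ge0. Qed.

Lemma velocity_space_L2 (v : 'rV[R]_d -> 'rV[R]_d) :
  velocity_space Omega v -> L2M Omega v.
Proof. by move=> Xv i j; rewrite (ord1 i); have [[]] := Xv j. Qed.

Lemma bstar_diag (u v : 'rV[R]_d -> 'rV[R]_d) : bstar Omega u v v = 0.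
Proof. exact: subrr. Qed.

(** Continuity of [F] bounds the quotients from above, so that [sup] dominates each of them. *)
Lemma dual_norm_bound (F : ('rV[R]_d -> 'rV[R]_d) -> R)
    (v : 'rV[R]_d -> 'rV[R]_d) :
  velocity_dual Omega F -> velocity_space Omega v ->
  ~ (v = cst 0 %[ae dx Omega]) ->
  F v <= dual_norm Omega F * norm2M Omega (grad Omega v).
Proof.
move=> [_ _ [C FC]] Xv v0.
(* When the gradient norm vanishes, continuity gives [F v <= 0], and the right side is 0. *)
have [N0|N0] := eqVneq (norm2M Omega (grad Omega v)) 0.
  by have := FC _ Xv; rewrite N0 !mulr0; exact: le_trans (ler_norm _).
have N_gt0 : 0 < norm2M Omega (grad Omega v).
  by rewrite lt_neqAle eq_sym N0 sqrtr_ge0.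
rewrite -ler_pdivrMr//; apply: ub_le_sup; last by exists v.
(* The maximum with 0 covers a negative [C] and the quotients with zero denominator, which evaluate
   to 0. *)
exists (Num.max C 0) => _ [w [Xw _ ->]].
have [->|M0] := eqVneq (norm2M Omega (grad Omega w)) 0.
  by rewrite invr0 mulr0 le_max lexx orbT.
rewrite ler_pdivrMr ?lt_neqAle 1?eq_sym ?M0 ?sqrtr_ge0//.
rewrite (le_trans (ler_norm _))// (le_trans (FC _ Xw))//.
by rewrite ler_wpM2r ?sqrtr_ge0// le_max lexx.
Qed.

End L2_inner.

(** * The energy estimate *)

Lemma finite_dim_subspaceD (R : realType) (V : lmodType R) (S : set V) v w :
  finite_dim_subspace S -> S v -> S w -> S (v + w).
Proof.
move=> [n [e ->]] [a ->] [b ->]; exists (fun i => a i + b i).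
by rewrite -big_split/=; apply: eq_bigr => i _; rewrite scalerDl.
Qed.

Theorem theorem2p1 (R : realType) (d : nat) (d23 : d = 2%N \/ d = 3%N)
    (Omega : domain R d)
    (T nu chi mu1 mu2 : R) (T_gt0 : 0 < T) (nu_gt0 : 0 < nu)
    (chi_gt0 : 0 < chi) (mu1_gt0 : 0 < mu1) (mu2_gt0 : 0 < mu2)
    (Xh : set ('rV[R]_d -> 'rV[R]_d)) (Qh : set ('rV[R]_d -> R))
    (Xh_findim : finite_dim_subspace Xh) (Qh_findim : finite_dim_subspace Qh)
    (Xh_conforming : Xh `<=` velocity_space Omega)
    (Qh_conforming : Qh `<=` pressure_space Omega)
    (f : R -> ('rV[R]_d -> 'rV[R]_d) -> R)
    (f_dual : forall t, `]0, T]%classic t -> velocity_dual Omega (f t))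
    (IHv : ('rV[R]_d -> 'rV[R]_d) -> ('rV[R]_d -> 'rV[R]_d))
    (IHp : ('rV[R]_d -> R) -> ('rV[R]_d -> R))
    (IHv_projection : L2_projection_vector Omega IHv)
    (IHp_projection : L2_projection Omega IHp)
    (u : R -> 'rV[R]_d -> 'rV[R]_d) (p : R -> 'rV[R]_d -> R)
    (u_L2 : forall t, `]0, T]%classic t -> L2M Omega (u t))
    (p_L2 : forall t, `]0, T]%classic t -> L2 Omega (p t))
    (vh dvh : R -> 'rV[R]_d -> 'rV[R]_d) (qh : R -> 'rV[R]_d -> R)
    (vh_Xh : forall t, `]0, T]%classic t -> Xh (vh t))
    (dvh_Xh : forall t, `]0, T]%classic t -> Xh (dvh t))
    (qh_Qh : forall t, `]0, T]%classic t -> Qh (qh t))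
    (dvh_derivative : forall t, `]0, T]%classic t ->
      L2_derivative_in Omega `]0, T] vh t (dvh t))
    (momentum : forall t, `]0, T]%classic t -> forall wh, Xh wh ->
      innerM Omega (dvh t) wh
      + bstar Omega (vh t) (vh t) wh
      + nu * innerM Omega (grad Omega (vh t)) (grad Omega wh)
      - inner Omega (qh t) (divergence Omega wh)
      - chi * innerM Omega (IHv (u t - vh t)) wh
      = f t wh)
    (mass : forall t, `]0, T]%classic t -> forall lh, Qh lh ->
      inner Omega (divergence Omega (vh t)) lh
      - mu1 * inner Omega (IHp (p t - qh t)) lh
      - mu2 * inner Omega (IHp (qh t) - qh t) lh
      = 0) :
  let alpha1 := Num.min mu1 (2 * mu2) in
  forall t, `]0, T]%classic t ->
    exists2 D : R,
      derivative_in `]0, T] (fun s => norm2M Omega (vh s) ^+ 2) t D &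
      D + nu * norm2M Omega (grad Omega (vh t)) ^+ 2
        + chi * norm2M Omega (IHv (vh t)) ^+ 2
        + alpha1 * norm2 Omega (qh t) ^+ 2
      <= chi * norm2M Omega (IHv (u t)) ^+ 2
         + mu1 * norm2 Omega (IHp (p t)) ^+ 2
         + nu^-1 * dual_norm Omega (f t) ^+ 2.
Proof.
move=> alpha1 t At.
have Xv := vh_Xh _ At; have Xdv := dvh_Xh _ At; have Qq := qh_Qh _ At.
have Vv := Xh_conforming _ Xv.
have Lv := velocity_space_L2 Vv.
have [Lq _ _] := Qh_conforming _ Qq.
have Mip := @innerM_sip R d Omega 1 d; have ip := @inner_sip R d Omega.
exists (2 * innerM Omega (dvh t) (vh t)).
  rewrite (_ : (fun s => _) = fun s => innerM Omega (vh s) (vh s)); last first.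
    by apply/funext => s; rewrite norm2M_sqr.
  apply: (sip_derivative Mip) => //; last exact: dvh_derivative.
  - by move=> s As; apply/velocity_space_L2/Xh_conforming/vh_Xh.
  - exact/velocity_space_L2/Xh_conforming.
(* In the supremum defining the dual norm only v <> 0 a.e. is allowed; for
   v = 0 a.e. the functional vanishes since v and v + v are then equal a.e. *)
have fv : 2 * f t (vh t) <= nu * norm2M Omega (grad Omega (vh t)) ^+ 2 +
    nu^-1 * dual_norm Omega (f t) ^+ 2.
  set N := norm2M _ _; set D := dual_norm _ _.
  have [v0|v0] := pselect (vh t = cst 0 %[ae dx Omega]).
    have -> : f t (vh t) = 0.
      have [fae flin _] := f_dual _ At.
      have Vvv := Xh_conforming _ (finite_dim_subspaceD Xh_findim Xv Xv).
      have : f t (vh t + vh t) = f t (vh t).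
        apply: fae => //; apply: filterS v0 => x /= v0 _.
        by rewrite -[LHS]/(vh t x + vh t x) v0// addr0.
      have := flin 1 _ _ Vv Vv; rewrite scale1r mul1r => ->; lra.
    by rewrite mulr0 addr_ge0// mulr_ge0 ?sqr_ge0 ?invr_ge0// ltW.
  have fDN : f t (vh t) <= D * N := dual_norm_bound (f_dual _ At) Vv v0.
  (* Young's inequality weighted by [nu], as a completed square. *)
  have : 0 <= nu * (N - nu^-1 * D) ^+ 2 by rewrite mulr_ge0 ?sqr_ge0// ltW.
  have -> : nu * (N - nu^-1 * D) ^+ 2 =
      nu * N ^+ 2 + nu^-1 * D ^+ 2 - 2 * (D * N).
    by field; rewrite gt_eqF.
  lra.
have Ivp := IHv_projection; have Ipp := IHp_projection.
have vrefl (w : 'rV[R]_d -> 'rV[R]_d) : w = w %[ae dx Omega] by exact: ae_eq_refl.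
have prefl (g : 'rV[R]_d -> R) : g = g %[ae dx Omega] by exact: ae_eq_refl.
have Lu := u_L2 _ At; have Lp := p_L2 _ At.
have LIv := orth_projection_closed Ivp Lv.
have LIq := orth_projection_closed Ipp Lq.
have := momentum _ At _ Xv; have := mass _ At _ Qq.
rewrite bstar_diag (orth_projectionB Mip vrefl Ivp Lu Lv).
rewrite (orth_projectionB ip prefl Ipp Lp Lq).
rewrite (sipBl ip LIq Lq Lq) (orth_projectionE ip prefl Ipp Lq Lq).
have := orth_projection_le ip prefl Ipp Lq.
have := sip_young ip (orth_projection_closed Ipp Lp) LIq.
have := sip_young Mip (orth_projection_closed Ivp Lu) LIv.
(* Symmetry gives the pressure-divergence terms of both equations the same form, so that they
   cancel. *)
move: fv; rewrite !norm2M_sqr !norm2_sqr (inner_sym _ (qh t)).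
set Iqq := inner _ (IHp (qh t)) (IHp (qh t)); set qq := inner _ (qh t) (qh t).
have Iqq0 : 0 <= Iqq by exact: inner_ge0.
have a1 : alpha1 <= mu1 by rewrite ge_min lexx.
have a2 : alpha1 <= 2 * mu2 by rewrite ge_min lexx orbT.
(* Twice the energy identity, with the Young bounds scaled by [chi] and [mu1], leaves
   [mu1 * Iqq + 2 * mu2 * (qq - Iqq)]. Both [Iqq] and [qq - Iqq] are nonnegative, so this is at
   least [alpha1 * qq]. *)
nra.
Qed.
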